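(* Let $\mathbb{F}\in\{\mathbb{R},\mathbb{C}\}$ and let $A\in\mathbb{F}^{n\times n}$ be normal, with eigenvalues $\lambda_1,\dots,\lambda_n$. Let $f,\varphi_1,\dots,\varphi_k$ be (scalar, complex-valued) functions defined at each eigenvalue of $A$. In the case $\mathbb{F}=\mathbb{R}$ assume in addition that for every eigenvalue $\lambda_j$ of $A$, \[ \overline{f(\lambda_j)}=f(\overline{\lambda_j})\quad\text{and}\quad \overline{\varphi_i(\lambda_j)}=\varphi_i(\overline{\lambda_j}),\quad i=1,\dots,k, \] so that $f(A),\varphi_1(A),\dots,\varphi_k(A)$ are real matrices. Let $\mathcal{P}_k(\mathbb{F})=\{\alpha_1\varphi_1+\dots+\alpha_k\varphi_k:\ \alpha_1,\dots,\alpha_k\in\mathbb{F}\}$. Then \[ \max_{v\in\mathbb{F}^n,\ \|v\|=1}\ \min_{p\in\mathcal{P}_k(\mathbb{F})}\|f(A)v-p(A)v\| \;=\; \min_{p\in\mathcal{P}_k(\mathbb{F})}\|f(A)-p(A)\|, \] where $\|\cdot\|$ denotes the Euclidean norm on vectors and the induced spectral norm on matrices.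
   Context: For a normal matrix $A=Q\Lambda Q^H$ with $Q$ unitary and $\Lambda=\mathrm{diag}(\lambda_1,\dots,\lambda_n)$, and a function $g$ defined on the eigenvalues, the matrix function is $g(A)=Q\,\mathrm{diag}(g(\lambda_1),\dots,g(\lambda_n))\,Q^H$. For $p=\sum_i\alpha_i\varphi_i$, $p(A)=\sum_i\alpha_i\varphi_i(A)$. *)

(* Defs.v *)
(* The scalar field is an arbitrary numClosedFieldType C
   (e.g. algC); its real elements (Num.real) play the role of R. *)
From HB Require Import structures.
From mathcomp Require Import all_boot all_order all_algebra.
Set Implicit Arguments. Unset Strict Implicit. Unset Printing Implicit Defensive.
Import Order.TTheory GRing.Theory Num.Theory.
Local Open Scope ring_scope.
Local Open Scope sesquilinear_scope.

Section Defs.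
Variable C : numClosedFieldType.

(* matrix function g(A) = Q diag(g(lambda_1),...,g(lambda_n)) Q^H,
   relative to a given unitary diagonalisation A = Q diag(lambda) Q^H *)
Definition mxfun n (Q : 'M[C]_n) (lam : 'I_n -> C) (g : C -> C) : 'M[C]_n :=
  Q *m diag_mx (\row_j g (lam j)) *m Q ^t*.

Definition mxcomb n k (Q : 'M[C]_n) (lam : 'I_n -> C)
  (phi : 'I_k -> C -> C) (alpha : 'I_k -> C) : 'M[C]_n :=
  \sum_(i < k) alpha i *: mxfun Q lam (phi i).

Definition vnorm n (v : 'cV[C]_n) : C := sqrtC (\sum_(i < n) `|v i 0| ^+ 2).

(* v is a vector of F^n, where F = R (if realF) or F = C (otherwise) *)
Definition inFvec (realF : bool) n (v : 'cV[C]_n) : Prop :=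
  realF -> forall i, v i 0 \is Num.real.

Definition inFcoef (realF : bool) k (alpha : 'I_k -> C) : Prop :=
  realF -> forall i, alpha i \is Num.real.

Definition inFmx (realF : bool) m n (M : 'M[C]_(m, n)) : Prop :=
  realF -> M \is a realmx.

Definition is_max (S : C -> Prop) (r : C) : Prop := S r /\ forall s, S s -> s <= r.
Definition is_min (S : C -> Prop) (r : C) : Prop := S r /\ forall s, S s -> r <= s.

Definition is_specnorm (realF : bool) n (M : 'M[C]_n) (r : C) : Prop :=
  is_max (fun t => exists x : 'cV[C]_n, [/\ inFvec realF x, vnorm x = 1 & t = vnorm (M *m x)]) r.
End Defs.

(* Main.v *)
(* With mu_j = |(Q^H v)_j|^2, the squared residual |(f - p)(A) v|^2 equals the mu-average of the
   numbers |f(lambda_j) - p(lambda_j)|^2, so the theorem is a minimax equality for a finite complex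
   Chebyshev approximation problem. An optimal p exists, and Gordan's alternative applied to the
   gradients of its active constraints yields weights mu for which p is also a minimiser of the
   weighted least-squares problem; any unit v with these weights attains the maximum. When F is the
   reals, only the total weight of each class {lambda, conj lambda} matters, and a real v with
   prescribed class weights is built from the real parts of (multiples of) the columns of Q.
   As C is an arbitrary numClosedFieldType there is no compactness argument: the optimal p is
   obtained one coordinate at a time, from suprema of sets definable in the real closed field of
   real elements of C, which exist by quantifier elimination. *)
Require Import Defs.
From HB Require Import structures.
From mathcomp Require Import all_boot all_order all_algebra.
From mathcomp Require Import lra polyrcf.
From mathcomp Require ordered_qelim qe_rcf.
From Stdlib Require Import Classical.
Set Implicit Arguments. Unset Strict Implicit. Unset Printing Implicit Defensive.
Import Order.TTheory GRing.Theory Num.Theory.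
Local Open Scope ring_scope.
Local Open Scope sesquilinear_scope.

(** * The real elements of C form a real closed field *)

(** Packaging the real elements as a type of their own lets them carry an [rcfType] structure, the
    setting of quantifier elimination. *)
Record creal (C : numClosedFieldType) :=
  CReal { creal_val :> C; creal_valP : creal_val \is Num.real }.

Section CReal.
Variable C : numClosedFieldType.
Local Notation R := (creal C).
Local Notation val := (@creal_val C).

HB.instance Definition _ := [isSub for val].
HB.instance Definition _ := [Choice of R by <:].
HB.instance Definition _ := [SubChoice_isSubIntegralDomain of R by <:].
HB.instance Definition _ := [SubIntegralDomain_isSubField of R by <:].
HB.instance Definition _ : Order.isPOrder ring_display R :=
  Order.CancelPartial.Pcan _ (@valK C _ R).
Lemma creal_total : total (<=%O : rel (R : porderType _)).
Proof. by move=> x y; apply/real_leVge/valP/valP. Qed.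
HB.instance Definition _ := Order.POrder_isTotal.Build _ R creal_total.

Lemma creal_val_zmod_morphism : zmod_morphism val. Proof. by []. Qed.
Lemma creal_val_monoid_morphism : monoid_morphism val. Proof. by []. Qed.
HB.instance Definition _ := GRing.isZmodMorphism.Build R C val
  creal_val_zmod_morphism.
HB.instance Definition _ := GRing.isMonoidMorphism.Build R C val
  creal_val_monoid_morphism.

Definition creal_norm (x : R) : R := CReal (normr_real (val x)).
Lemma creal_normD x y : creal_norm (x + y) <= creal_norm x + creal_norm y.
Proof. exact: ler_normD. Qed.
Lemma creal_norm_eq0 x : creal_norm x = 0 -> x = 0.
Proof. by move=> /(congr1 val)/normr0_eq0 ?; apply/val_inj. Qed.
Lemma creal_normMn x n : creal_norm (x *+ n) = creal_norm x *+ n.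
Proof. by apply/val_inj; rewrite /= !rmorphMn/= normrMn. Qed.
Lemma creal_normN x : creal_norm (- x) = creal_norm x.
Proof. by apply/val_inj; apply: normrN. Qed.
Lemma creal_add_gt0 (x y : R) : (0 : R) < x -> (0 : R) < y -> (0 : R) < x + y.
Proof. exact: addr_gt0. Qed.
Lemma creal_leVge (x y : R) : (0 : R) <= x -> (0 : R) <= y -> (x <= y) || (y <= x).
Proof. exact: ger_leVge. Qed.
Lemma creal_normM : {morph creal_norm : x y / x * y}.
Proof. by move=> *; apply/val_inj; apply: normrM. Qed.
Lemma creal_le_def (x y : R) : (x <= y) = (creal_norm (y - x) == y - x).
Proof. exact: ler_def. Qed.
HB.instance Definition _ := Num.Zmodule_isNormed.Build _ R
  creal_normD creal_norm_eq0 creal_normMn creal_normN.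
HB.instance Definition _ := Num.isNumRing.Build R
  creal_add_gt0 creal_leVge creal_normM creal_le_def.

Lemma map_creal_conj_root (p : {poly R}) (z : C) :
  root (map_poly val p) z -> root (map_poly val p) z^*.
Proof.
rewrite !rootE => /eqP pz.
have <- : map_poly Num.conj (map_poly val p) = map_poly val p.
  rewrite -map_poly_comp; apply: eq_map_poly => x /=.
  by rewrite conj_Creal ?creal_valP.
by rewrite horner_map /= pz rmorph0.
Qed.

(** Induction on the size of [p], splitting off one factor at a time over the algebraically closed
    field [C]. A real root outside [[a, b]] gives a linear factor with equal signs at [a] and [b]; a
    non-real root pairs with its conjugate into a positive quadratic factor. *)
Lemma creal_sign_change (p : {poly R}) (a b : R) : a <= b ->
  (exists2 x, a <= x <= b & root p x) \/ 0 < p.[a] * p.[b].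
Proof.
move=> leab; have [n] := ubnP (size p); elim: n p => // n IH p szp.
have [->|p0] := eqVneq p 0; first by left; exists a; rewrite ?lexx ?root0.
have factor d q : p = q * d -> (1 < size d)%N -> 0 < d.[a] * d.[b] ->
    (exists2 x, a <= x <= b & root p x) \/ 0 < p.[a] * p.[b].
  move=> pE szd d0.
  have q0: q != 0 by apply: contraNneq p0 => q0; rewrite pE q0 mul0r.
  have d'0: d != 0 by rewrite -size_poly_gt0 ltnW.
  have szq : (size q < n)%N.
    move: szp; rewrite ltnS pE size_mul // => szp; apply: leq_trans szp.
    by move: szd; case: (size d) => [|[|k]] // _; rewrite !addnS /= ltnS leq_addr.
  have [[x xab qx]|qab] := IH q szq.
    by left; exists x; rewrite // pE rootM qx.
  by right; rewrite pE !hornerM mulrACA mulr_gt0.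
have [szp1|szp1] := leqP (size p) 1.
  right; move: p0; rewrite (size1_polyC szp1) polyC_eq0 !hornerC => p0.
  by rewrite -expr2 exprn_even_gt0.
have [z pz] : exists z, root (map_poly val p) z.
  by apply/closed_rootP; rewrite size_map_poly neq_ltn szp1 orbT.
have [zr|zr] := boolP (z \is Num.real).
  pose x : R := CReal zr.
  have px : root p x by rewrite -(fmorph_root val).
  have [xab|xab] := boolP (a <= x <= b); first by left; exists x.
  have /factor_theorem[q pE] := px.
  apply: factor pE _ _; first by rewrite size_XsubC.
  rewrite !hornerXsubC.
  move: xab; rewrite negb_and -!ltNge => /orP[xa|bx].
    by rewrite mulr_gt0 // subr_gt0 // (lt_le_trans xa).
  by rewrite nmulr_rgt0 subr_lt0 // (le_lt_trans leab).
(* The real quadratic with roots [z] and its conjugate. It is positive everywhere because the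
   imaginary part of [z] is nonzero. *)
pose d : {poly R} := ('X - (CReal (Creal_Re z))%:P) ^+ 2 + ((CReal (Creal_Im z)) ^+ 2)%:P.
have dE : map_poly val d = ('X - z%:P) * ('X - (z^*)%:P).
  rewrite /d rmorphD rmorphXn rmorphB /= map_polyX !map_polyC /= .
  rewrite [X in ('X - X%:P) * _]Crect [X in _ * ('X - X^*%:P)]Crect.
  rewrite conjC_rect ?Creal_Re ?Creal_Im //.
  have -> : 'Im z * 'Im z = - ('i * 'Im z) ^+ 2 by rewrite exprMn sqrCi mulN1r opprK.
  by rewrite polyCN polyC_exp !polyCD polyCN !opprD !opprK !addrA -subr_sqr mulrC.
have szd : size d = 3.
  by rewrite -(size_map_poly val) dE size_mul ?polyXsubC_eq0 // !size_XsubC.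
have : d %| p.
  rewrite -(dvdp_map val) /= dE Gauss_dvdp; last first.
    by rewrite coprimep_XsubC root_XsubC -CrealE.
  by rewrite !dvdp_XsubCl pz map_creal_conj_root.
case/dvdpP => q pE; apply: factor pE _ _; first by rewrite szd.
have dp x : 0 < d.[x].
  rewrite /d !hornerE ltr_wpDl ?sqr_ge0 // exprn_even_gt0 //=.
  by apply: contraNneq zr => /(congr1 val)/= i0; apply/Creal_ImP.
by rewrite mulr_gt0.
Qed.

Lemma creal_ivt : Num.real_closed_axiom R.
Proof.
move=> p a b leab /andP[pa pb].
have [//|/lt_geF] := creal_sign_change p leab.
by rewrite mulr_le0_ge0.
Qed.
HB.instance Definition _ := Num.RealField_isClosed.Build R creal_ivt.
End CReal.

(** * Suprema of definable sets *)

Section DefinableSup.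
Import ordered_qelim.ord.
Variable R : rcfType.
Implicit Types (e s : seq R) (f : formula R).

Definition avoids s (x y : R) := forall z, z \in s -> ~~ (x <= z <= y).

Lemma avoids_cat s1 s2 x y : avoids (s1 ++ s2) x y -> avoids s1 x y /\ avoids s2 x y.
Proof. by move=> h; split=> z zs; apply: h; rewrite mem_cat zs ?orbT. Qed.

(** The breakpoints are the roots of [p]: between two of them the intermediate value theorem rules
    out a change of sign. *)
Lemma poly_sign_const (p : {poly R}) :
  exists s, forall x y, x <= y -> avoids s x y -> Num.sg p.[x] = Num.sg p.[y].
Proof.
have [->|p0] := eqVneq p 0; first by exists [::] => x y _ _; rewrite !horner0.
exists (rootsR p) => x y lexy av.
have [neg|pos] := lerP (p.[x] * p.[y]) 0.
  have [z zxy rz] := polyrcf.poly_ivt lexy neg.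
  have zs : z \in rootsR p by rewrite -(roots_on_rootsR p0) in_itv.
  by have := av z zs; move: zxy; rewrite in_itv /= => ->.
have := gtr0_sg pos; rewrite sgrM.
by case: sgrP; case: sgrP => //=; rewrite ?mulr0 ?mul0r ?mulr1 ?mul1r ?mulrN1 ?opprK => *; lra.
Qed.

(** Abstracting variable [i] and evaluating the others in [e] leaves a univariate polynomial. *)
Lemma eval_term_poly e i (t : GRing.term R) : GRing.rterm t ->
  exists p : {poly R}, forall x, GRing.eval (set_nth 0 e i x) t = p.[x].
Proof.
move=> rt; exists (qe_rcf.eval_poly e (qe_rcf.abstrX i (qe_rcf.to_rterm t))) => x.
by rewrite qe_rcf.abstrXP qe_rcf.evalE qe_rcf.to_rtermE.
Qed.

Lemma eval_sign_const e i (t1 t2 : GRing.term R) : GRing.rterm t1 && GRing.rterm t2 ->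
  exists s, forall x y, x <= y -> avoids s x y ->
    Num.sg (GRing.eval (set_nth 0 e i x) t1 - GRing.eval (set_nth 0 e i x) t2) =
    Num.sg (GRing.eval (set_nth 0 e i y) t1 - GRing.eval (set_nth 0 e i y) t2).
Proof.
case/andP=> /(eval_term_poly e i)[p1 E1] /(eval_term_poly e i)[p2 E2].
have [s sP] := poly_sign_const (p1 - p2); exists s => x y lexy av.
by rewrite !E1 !E2 -!hornerN -!hornerD; apply: sP.
Qed.

Lemma qf_eval_const e i f : qf_form f -> rformula f ->
  exists s, forall x y, x <= y -> avoids s x y ->
    qf_eval (set_nth 0 e i x) f = qf_eval (set_nth 0 e i y) f.
Proof.
elim: f => //=.
- by move=> b _ _; exists [::].
- move=> t1 t2 _ /(eval_sign_const e i)[s sP]; exists s => x y xy /(sP x y xy) E.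
  by rewrite -subr_eq0 -sgr_eq0 E sgr_eq0 subr_eq0.
- move=> t1 t2 _ /(eval_sign_const e i)[s sP]; exists s => x y xy /(sP x y xy) E.
  by rewrite -subr_lt0 -sgr_lt0 E sgr_lt0 subr_lt0.
- move=> t1 t2 _ /(eval_sign_const e i)[s sP]; exists s => x y xy /(sP x y xy) E.
  by rewrite -subr_le0 -sgr_le0 E sgr_le0 subr_le0.
- move=> f1 IH1 f2 IH2 /andP[q1 q2] /andP[r1 r2].
  have [s1 s1P] := IH1 q1 r1; have [s2 s2P] := IH2 q2 r2.
  by exists (s1 ++ s2) => x y xy /avoids_cat[a1 a2]; rewrite (s1P x y) // (s2P x y).
- move=> f1 IH1 f2 IH2 /andP[q1 q2] /andP[r1 r2].
  have [s1 s1P] := IH1 q1 r1; have [s2 s2P] := IH2 q2 r2.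
  by exists (s1 ++ s2) => x y xy /avoids_cat[a1 a2]; rewrite (s1P x y) // (s2P x y).
- move=> f1 IH1 f2 IH2 /andP[q1 q2] /andP[r1 r2].
  have [s1 s1P] := IH1 q1 r1; have [s2 s2P] := IH2 q2 r2.
  by exists (s1 ++ s2) => x y xy /avoids_cat[a1 a2]; rewrite (s1P x y) // (s2P x y).
- move=> f1 IH1 q1 r1; have [s sP] := IH1 q1 r1.
  by exists s => x y xy a; rewrite (sP x y).
Qed.

(** Quantifier elimination yields an equivalent quantifier-free formula, whose truth changes only at
    roots of its finitely many atoms. *)
Lemma holds_const e i f : exists s, forall x y, x <= y -> avoids s x y ->
  (holds (set_nth 0 e i x) f <-> holds (set_nth 0 e i y) f).
Proof.
pose wf := @qe_rcf.wf_QE_wproj R; pose valid := @qe_rcf.valid_QE_wproj R.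
pose g := quantifier_elim (fun i bc => qe_rcf.qfr_to_formula (@qe_rcf.wproj R i bc)) (to_rform f).
have /andP[qg rg] := quantifier_elim_wf wf (to_rform_rformula f).
have [s sP] := qf_eval_const e i qg rg; exists s => x y xy a.
have hE z : holds (set_nth 0 e i z) f <-> qf_eval (set_nth 0 e i z) g.
  split=> [/(rwP (proj_satP wf valid _ _))|] //.
  by move/(rwP (proj_satP wf valid _ _)).
by rewrite !hE (sP x y).
Qed.

Lemma least_in_seq (P : R -> Prop) (b : R) s : P b ->
  exists2 c, P c & forall z, z \in s -> z < c -> ~ P z.
Proof.
elim: s b => [|a s IH] b Pb; first by exists b.
have [c Pc cP] := IH b Pb.
have [[Pa ltac]|h] := classic (P a /\ a < c).
  exists a => // z; rewrite inE => /predU1P[->|zs za]; first by rewrite ltxx.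
  exact: cP zs (lt_trans za ltac).
exists c => // z; rewrite inE => /predU1P[->|zs zc]; last exact: cP zs zc.
by move=> ac Pa; apply: h.
Qed.

(* A definable set is all or nothing between consecutive breakpoints, so the least upper bound
   found among b and the breakpoints is the supremum. *)
Lemma definable_sup (S : R -> Prop) e i f a b :
  (forall x, S x <-> holds (set_nth 0 e i x) f) ->
  S a -> (forall x, S x -> x <= b) ->
  exists c, (forall x, S x -> x <= c) /\ (forall d, (forall x, S x -> x <= d) -> c <= d).
Proof.
move=> SE Sa Sb; have [s sP] := holds_const e i f.
have [c cub cP] := @least_in_seq (fun c => forall x, S x -> x <= c) b s Sb.
exists c; split=> // d dub; rewrite leNgt; apply/negP => dc.
(* A breakpoint below [c] is not an upper bound of [S], so some element of [S] exceeds it; the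
   largest of these finitely many elements serves for all. *)
have [x Sx sx] : exists2 x, S x & forall z, z \in s -> z < c -> z < x.
  elim: s {sP} cP => [|p s IH] cP; first by exists a.
  have [x Sx xP] := IH (fun z zs => cP z (@mem_behead _ (p :: s) z zs)).
  have [pc|cp] := ltrP p c; last first.
    exists x => // z; rewrite inE => /predU1P[->|]; last exact: xP.
    by rewrite ltNge cp.
  have [y [Sy py]] : exists y, S y /\ p < y.
    apply: NNPP => h; apply: (cP p) => //; first exact: mem_head.
    by move=> y Sy; rewrite leNgt; apply/negP => py; apply: h; exists y.
  have [xy|yx] := lerP x y.
    exists y => // z; rewrite inE => /predU1P[->//|zs zc].
    exact: lt_le_trans (xP z zs zc) xy.
  exists x => // z; rewrite inE => /predU1P[-> _|]; last exact: xP.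
  exact: lt_trans py yx.
(* Breakpoints below [c] lie below [x], so none is in [[x, m]] and [m] inherits membership in [S],
   although it exceeds the upper bound [d]. *)
pose m := (d + c) / 2.
have dm : d < m by rewrite /m; lra.
have mc : m < c by rewrite /m; lra.
have xm : x <= m by apply: le_trans (dub x Sx) (ltW dm).
suff /dub : S m by rewrite leNgt dm.
apply/SE; apply/(sP x m) => //; last by apply/SE.
move=> z zs; apply/negP => /andP[xz zm].
by have := sx z zs (le_lt_trans zm mc); rewrite ltNge xz.
Qed.
End DefinableSup.

(** * Minimising a maximum of convex quadratics *)

(** The map [kap] cuts the coordinates into blocks. Later a block holds the real and imaginary parts
    of one complex residual, so that [ssq] is its squared modulus. *)
Definition ssq (R : nzRingType) N (I : finType) (kap : 'I_N -> I) (y : 'rV[R]_N) (i : I) : R :=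
  \sum_(l | kap l == i) y 0 l ^+ 2.

(** Bounding the maximum over [i] by a conjunction keeps the condition a first-order formula with
    polynomial atoms. *)
Definition sublevel (R : numDomainType) m N (I : finType) (kap : 'I_N -> I)
    (a : 'rV[R]_N) (B : 'M[R]_(m, N)) (t : R) (x : 'rV[R]_m) :=
  forall i, ssq kap (a + x *m B) i <= t.

Lemma ssq_ge0 (R : realDomainType) N (I : finType) (kap : 'I_N -> I) (y : 'rV[R]_N) i :
  0 <= ssq kap y i.
Proof. by apply: sumr_ge0 => l _; apply: sqr_ge0. Qed.

(** * Sublevel sets as first-order formulas *)

Section Encoding.
Import ordered_qelim.ord.
Variable R : rcfType.
Implicit Types (e s : seq R) (f : formula R).

Lemma holds_forall_iota e n f :
  holds e (foldr (@Forall R) f (iota (size e) n)) <->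
  forall s, size s = n -> holds (e ++ s) f.
Proof.
elim: n e => [|n IH] e /=.
  by split=> [h s /size0nil->|/(_ [::] erefl)]; rewrite cats0.
have sE x : set_nth 0 e (size e) x = rcons e x.
  by elim: e {IH} => //= y e ->.
split=> [h [|x s] // [ss]|h x].
  have /IH h2 : holds (rcons e x) (foldr (@Forall R) f (iota (size (rcons e x)) n)).
    by rewrite size_rcons -sE; apply: h.
  by rewrite -cat_rcons; apply: h2.
rewrite sE -(size_rcons e x); apply/IH => s ss.
by rewrite cat_rcons; apply: h; rewrite /= ss.
Qed.

Lemma holds_bigand e (I : eqType) (r : seq I) (F : I -> formula R) :
  holds e (\big[And/Bool true]_(i <- r) F i) <-> forall i, i \in r -> holds e (F i).
Proof.
elim: r => [|i r IH]; first by rewrite big_nil.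
rewrite big_cons /= IH; split=> [[h1 h2] j|h].
  by rewrite inE => /predU1P[->|/h2].
by split=> [|j jr]; apply: h; rewrite inE ?eqxx ?jr ?orbT.
Qed.

Lemma eval_bigadd e (I : Type) (r : seq I) (P : pred I) (F : I -> GRing.term R) :
  GRing.eval e (\big[@GRing.Add R/GRing.NatConst R 0]_(i <- r | P i) F i) =
  \sum_(i <- r | P i) GRing.eval e (F i).
Proof. exact: (big_morph (GRing.eval e)). Qed.

Variables (m N : nat) (I : finType) (kap : 'I_N -> I).
Variables (a : 'rV[R]_N) (B : 'M[R]_(m, N)).

(* Variable 0 is a free bound z, variable 1 the level t, variable j.+2 the coordinate x_j. *)
Definition sublevel_formula : formula R :=
  \big[And/Bool true]_(i <- enum I) Le
    (\big[@GRing.Add R/GRing.NatConst R 0]_(l | kap l == i) GRing.Exp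
       (GRing.Add (GRing.Const (a 0 l))
         (\big[@GRing.Add R/GRing.NatConst R 0]_(j < m)
            GRing.Mul (GRing.Var R j.+2) (GRing.Const (B j l)))) 2)
    (GRing.Var R 1).

Lemma holds_sublevel z t s :
  holds [:: z, t & s] sublevel_formula <-> sublevel kap a B t (\row_j s`_j).
Proof.
rewrite holds_bigand.
have E i : GRing.eval [:: z, t & s]
    (\big[@GRing.Add R/GRing.NatConst R 0]_(l | kap l == i) GRing.Exp
       (GRing.Add (GRing.Const (a 0 l))
         (\big[@GRing.Add R/GRing.NatConst R 0]_(j < m)
            GRing.Mul (GRing.Var R j.+2) (GRing.Const (B j l)))) 2) =
    ssq kap (a + (\row_j s`_j) *m B) i.
  rewrite eval_bigadd; apply: eq_bigr => l _ /=; rewrite eval_bigadd.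
  by rewrite !mxE; congr ((_ + _) ^+ 2); apply: eq_bigr => j _; rewrite !mxE.
by split=> h i; [have := h i; rewrite mem_enum => /(_ isT)|move=> _; have := h i];
  rewrite /= E.
Qed.

Lemma row_of_seq (x : 'rV[R]_m) : exists2 s, size s = m & x = \row_j s`_j.
Proof.
exists [seq x 0 j | j <- enum 'I_m]; first by rewrite size_map size_enum_ord.
apply/rowP => j; rewrite mxE (nth_map j) ?size_enum_ord // nth_ord_enum.
by [].
Qed.

Lemma holds_forall_sublevel z t g (P : R -> R -> 'rV[R]_m -> Prop) :
  (forall s, size s = m -> holds [:: z, t & s] g <-> P z t (\row_j s`_j)) ->
  holds [:: z; t] (foldr (@Forall R) (Implies sublevel_formula g) (iota 2 m)) <->
  forall x, sublevel kap a B t x -> P z t x.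
Proof.
move=> gP; rewrite (@holds_forall_iota [:: z; t]); split=> [h x|h s ss /=].
  by have [s ss ->] := row_of_seq x; move/(holds_sublevel z)=> /(h s ss)/gP; apply.
by move/holds_sublevel => hs; apply/gP => //; apply: h.
Qed.

(** The infimum of the attainable levels is obtained as the supremum of the definable set [L] of
    their lower bounds. The index [i0] ensures that 0 is one of these. *)
Lemma sublevel_inf b x0 : sublevel kap a B b x0 -> forall i0 : I,
  exists c, (forall t x, sublevel kap a B t x -> c <= t) /\
    forall t, c < t -> exists x, sublevel kap a B t x.
Proof.
move=> bx0 i0.
pose L z := forall t x, sublevel kap a B t x -> z <= t.
have [|||c [cub cl]] := @definable_sup R L [::] 0
    (Forall 1 (foldr (@Forall R) (Implies sublevel_formula
        (Le (GRing.Var R 0) (GRing.Var R 1))) (iota 2 m))) 0 b.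
- move=> z; split=> [Lz t|h t].
    by apply/(holds_forall_sublevel (P := fun z t _ => z <= t)) => // x; apply: Lz.
  by apply/(holds_forall_sublevel (g := Le (GRing.Var R 0) (GRing.Var R 1))
    (P := fun z t _ => z <= t)); last exact: h.
- by move=> t x /(_ i0); apply: le_trans; apply: ssq_ge0.
- by move=> z /(_ _ _ bx0).
exists c; split=> [t x tx|t ct]; first by apply: cl => z /(_ _ _ tx).
apply: NNPP => h; have := cub t; rewrite leNgt ct => /(_ _)/negP; apply=> //.
move=> t' x t'x; rewrite leNgt; apply/negP => t't; apply: h.
by exists x => i; apply: le_trans (t'x i) (ltW t't).
Qed.
End Encoding.

Section FirstCoordinate.
Import ordered_qelim.ord.

(* c is the supremum of the lower bounds for x_0 on the sublevel sets of levels above t0. *)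
Lemma sublevel_first_coord (R : rcfType) m N (I : finType) (kap : 'I_N -> I)
    (a : 'rV[R]_N) (B : 'M[R]_(m.+1, N)) (t0 K : R) :
  (forall x, sublevel kap a B (t0 + 1) x -> `|x 0 0| <= K) ->
  (forall t, t0 < t -> exists x, sublevel kap a B t x) ->
  exists c, forall t e, t0 < t -> 0 < e -> exists2 x, sublevel kap a B t x & `|x 0 0 - c| <= e.
Proof.
move=> Kub ne.
have sub t t' x : t <= t' -> sublevel kap a B t x -> sublevel kap a B t' x.
  by move=> tt' tx i; apply: le_trans (tx i) tt'.
pose L z := exists t, t0 < t /\ forall x, sublevel kap a B t x -> z <= x 0 0.
have [|||c [cub cl]] := @definable_sup R L [::] 0
    (Exists 1 (And (Lt (GRing.Const t0) (GRing.Var R 1))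
      (foldr (@Forall R) (Implies (sublevel_formula kap a B)
        (Le (GRing.Var R 0) (GRing.Var R 2))) (iota 2 m.+1)))) (- K) K.
- have gP z t (s : seq R) : size s = m.+1 ->
    holds [:: z, t & s] (Le (GRing.Var R 0) (GRing.Var R 2)) <->
      z <= (\row_j s`_j : 'rV[R]_m.+1) 0 0 by rewrite !mxE.
  move=> z; split=> [[t [t0t tP]]|[t [t0t tP]]]; exists t; split=> //.
    by apply/(holds_forall_sublevel kap a B (P := fun z t x => z <= x 0 0)) => // s; apply: gP.
  apply/(holds_forall_sublevel kap a B (g := Le (GRing.Var R 0) (GRing.Var R 2))
    (P := fun z t x => z <= x 0 0)); last exact: tP.
  by move=> s; apply: gP.
- by exists (t0 + 1); split=> [|x /Kub]; [rewrite ltrDl|rewrite ler_norml => /andP[]].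
- move=> z [t [t0t tP]].
  have [|x xP] := ne (Num.min t (t0 + 1)); first by rewrite lt_min t0t ltrDl ltr01.
  apply: le_trans (tP x _) _; first by apply: sub xP; rewrite ge_min lexx.
  by apply: le_trans (ler_norm _) (Kub x _); apply: sub xP; rewrite ge_min lexx orbT.
exists c => t e t0t e0.
have [z [[t2 [t02 t2P]] zc]] : exists z, L z /\ c - e < z.
  apply: NNPP => h; have : c <= c - e; last by rewrite lerDl oppr_ge0 leNgt e0.
  by apply: cl => z Lz; rewrite leNgt; apply/negP => lt; apply: h; exists z.
apply: NNPP => h.
(* On a smaller sublevel set the first coordinates are at least [z > c - e]; if none is within [e]
   of [c], all exceed [c + e], which contradicts the choice of [c]. *)
have : L (c + e).
  exists (Num.min t t2); split=> [|x xP]; first by rewrite lt_min t0t.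
  rewrite leNgt; apply/negP => xc; apply: h; exists x.
    by apply: sub xP; rewrite ge_min lexx.
  have : z <= x 0 0 by apply: t2P; apply: sub xP; rewrite ge_min lexx orbT.
  by rewrite ler_norml => ?; apply/andP; split; lra.
by move/cub; rewrite gerDl leNgt e0.
Qed.

End FirstCoordinate.

(** * Attainment of the minimal level *)

Section Attain.
Variables (R : rcfType) (N : nat) (I : finType) (kap : 'I_N -> I).

(** The inequality [|y| <= 1 + y ^+ 2] gives a bound free of square roots. *)
Lemma ssq_coord (y : 'rV[R]_N) (t : R) : (forall i, ssq kap y i <= t) ->
  forall l, `|y 0 l| <= 1 + t.
Proof.
move=> yt l; have := yt (kap l); rewrite /ssq (bigD1 l) //=.
set r := \sum_(_ | _) _ => h.
have r0 : 0 <= r by apply: sumr_ge0 => j _; apply: sqr_ge0.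
by rewrite ler_norml; apply/andP; split; nra.
Qed.

(** Expand the squares, bound the entries of [u] by [1 + t] and [d ^+ 2] by [|d|], then extend the
    sum to all coordinates to get a constant independent of [i]. *)
Lemma ssq_perturb (u b : 'rV[R]_N) (t d : R) i : `|d| <= 1 ->
  (forall i, ssq kap u i <= t) ->
  ssq kap (u + d *: b) i <=
    t + `|d| * (\sum_l (2 * (1 + t) * `|b 0 l| + b 0 l ^+ 2)).
Proof.
move=> d1 ut; have t0 : 0 <= t by apply: le_trans (ut i); apply: ssq_ge0.
apply: le_trans (lerD (ut i) (lexx _)).
rewrite mulr_sumr /ssq; apply: (@le_trans _ _ (\sum_(l | kap l == i)
   (u 0 l ^+ 2 + `|d| * (2 * (1 + t) * `|b 0 l| + b 0 l ^+ 2)))).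
  apply: ler_sum => l _; rewrite !mxE sqrrD -addrA lerD2l mulrDr.
  apply: lerD.
    apply: le_trans (ler_norm _) _; rewrite normrMn !normrM -mulr_natl.
    have h := ssq_coord ut l.
    have := ler_wpM2r (mulr_ge0 (normr_ge0 d) (normr_ge0 (b 0 l))) h.
    by nra.
  rewrite exprMn ler_wpM2r ?sqr_ge0 // -real_normK ?num_real // expr2.
  exact: ler_piMr.
rewrite big_split lerD2l [leRHS](bigID (fun l => kap l == i)) /= lerDl.
apply: sumr_ge0 => l _; apply: mulr_ge0 => //; apply: addr_ge0 (sqr_ge0 _).
by rewrite mulr_ge0 // mulr_ge0 // addr_ge0.
Qed.

Definition coercive m (a : 'rV[R]_N) (B : 'M[R]_(m, N)) :=
  forall t, exists K : R, forall x, sublevel kap a B t x -> forall j, `|x 0 j| <= K.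

(** This replaces compactness. By induction on the number of variables, the first coordinate is
    frozen at the limit value [c], and the slice there is shown to satisfy the same hypotheses. *)
Lemma sublevel_nested m (a : 'rV[R]_N) (B : 'M[R]_(m, N)) (t0 : R) :
  coercive a B -> (forall t, t0 < t -> exists x, sublevel kap a B t x) ->
  exists x, sublevel kap a B t0 x.
Proof.
elim: m a B => [|m IH] a B co ne.
  exists 0 => i; apply/ler_addgt0Pr => e e0.
  have [|x /(_ i)] := ne (t0 + e); first by rewrite ltrDl.
  by rewrite (flatmx0 B) !mulmx0.
have [K KP] := co (t0 + 1).
have [c cP] := sublevel_first_coord (fun x xP => KP x xP 0) ne.
pose b : 'rV[R]_N := usubmx (B : 'M_(1 + m, N)).
pose B' : 'M[R]_(m, N) := dsubmx (B : 'M_(1 + m, N)).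
have xE (z : R) (y : 'rV[R]_m) :
    (row_mx z%:M y : 'rV_(1 + m)) *m (B : 'M_(1 + m, N)) = z *: b + y *m B'.
  by rewrite -[X in _ *m X](@vsubmxK _ 1 m) mul_row_col mul_scalar_mx.
have slice t y : sublevel kap (a + c *: b) B' t y <->
    sublevel kap a B t (row_mx c%:M y : 'rV_(1 + m)).
  by rewrite /sublevel xE addrA.
have [||y /slice yP] := IH (a + c *: b) B'; last by exists (row_mx c%:M y : 'rV_(1 + m)).
- move=> t; have [K' K'P] := co t; exists K' => y /slice/K'P h j.
  have -> : y 0 j = (row_mx c%:M y : 'rV_(1 + m)) 0 (rshift 1 j) by rewrite row_mxEr.
  exact: h.
(* A point of level [t1] with first coordinate near [c] is moved onto the slice; the slack [t - t1]
   pays for the move, whose cost per unit is at most [M]. The divisor [M + 1] is nonzero even if [M]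
   is 0. *)
move=> t t0t; pose t1 := (t0 + t) / 2.
have t01 : t0 < t1 by rewrite /t1; lra.
have t1t : t1 < t by rewrite /t1; lra.
pose M := \sum_l (2 * (1 + t1) * `|b 0 l| + b 0 l ^+ 2).
have [x0 x0P] := ne _ t01.
have [i0|noI] := pickP (fun _ : I => true); last by exists 0 => i; have := noI i.
have t1_ge0 : 0 <= t1 by apply: le_trans (x0P i0); apply: ssq_ge0.
have M0 : 0 <= M.
  apply: sumr_ge0 => l _; apply: addr_ge0 (sqr_ge0 _).
  by rewrite mulr_ge0 // mulr_ge0 // addr_ge0.
have gap : 0 < (t - t1) / (M + 1) by rewrite divr_gt0 ?subr_gt0 // ltr_wpDl.
have [|x xP xc] := cP t1 (Num.min 1 ((t - t1) / (M + 1))) t01.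
  by rewrite lt_min ltr01.
pose z := x 0 0; pose y : 'rV[R]_m := rsubmx (x : 'rV_(1 + m)).
have xzy : x = row_mx z%:M y :> 'rV_(1 + m).
  rewrite -[LHS](@hsubmxK _ 1 1 m); congr row_mx.
  apply/matrixP => p q; rewrite !ord1 !mxE eqxx mulr1n; congr (x _ _).
  exact: val_inj.
exists y => i1; have {}xP j : ssq kap (a + (z *: b + y *m B')) j <= t1.
  by rewrite -xE -xzy; apply: xP.
have -> : a + c *: b + y *m B' = a + (z *: b + y *m B') + (c - z) *: b.
  by rewrite scalerBl -!addrA; congr (_ + _);
     rewrite [RHS]addrC -!addrA addNr addr0 addrC.
move: xc; rewrite distrC -/z le_min => /andP[d1 d2].
apply: le_trans (ssq_perturb b i1 d1 xP) _; rewrite -/M -lerBrDl.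
apply: le_trans (ler_wpM2r M0 d2) _.
by rewrite mulrAC ler_pdivrMr ?ltr_wpDl // ler_wpM2l ?subr_ge0 ?(ltW t1t) // lerDl.
Qed.

Lemma sublevel_min (i0 : I) m (a : 'rV[R]_N) (B : 'M[R]_(m, N)) :
  exists x t, sublevel kap a B t x /\ forall t' x', sublevel kap a B t' x' -> t <= t'.
Proof.
(* A row basis of [B] reaches the same vectors [x *m B]; injectivity then makes the sublevel sets
   bounded. *)
wlog freeB : m B / row_free B.
  move=> hw; have [x [t [xt tmin]]] := hw _ _ (row_base_free B).
  have BE := mulmx_base B.
  exists (x *m pinvmx (col_base B)), t; split=> [i|t' x' x't'].
    suff -> : x *m pinvmx (col_base B) *m B = x *m row_base B by apply: xt.
    by rewrite -[X in _ *m X]BE mulmxA mulmxKpV ?submx_full ?col_base_full.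
  by apply: (tmin t' (x' *m col_base B)) => i; rewrite -mulmxA BE; apply: x't'.
have co b : coercive b B.
  (* Recover [x] from [x *m B] through [pinvmx B], each entry of [x *m B] being at most
     [1 + t + |b 0 l|] in modulus. Summing over [j] makes the bound uniform in the coordinate. *)
  move=> t; exists (\sum_l \sum_j (1 + t + `|b 0 l|) * `|pinvmx B l j|) => x xt j.
  have -> : x 0 j = \sum_l (x *m B) 0 l * pinvmx B l j.
    by rewrite -[in LHS](mulmxKp freeB x) mxE.
  apply: le_trans (ler_norm_sum _ _ _) _; apply: ler_sum => l _.
  rewrite (bigD1 j) //= normrM -[leLHS]addr0; apply: lerD; last first.
    apply: sumr_ge0 => k _; rewrite mulr_ge0 // addr_ge0 //.
    exact: le_trans (normr_ge0 _) (ssq_coord xt l).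
  rewrite ler_wpM2r //; have := ssq_coord xt l; rewrite mxE => h.
  have -> : (x *m B) 0 l = (b 0 l + (x *m B) 0 l) - b 0 l by rewrite addrC addKr.
  by apply: le_trans (ler_normB _ _) _; rewrite lerD2r.
have x0P : sublevel kap a B (\sum_i ssq kap (a + 0 *m B) i) 0.
  move=> i; rewrite (bigD1 i) //= lerDl sumr_ge0 // => j _; exact: ssq_ge0.
have [t [tlow tP]] := sublevel_inf x0P i0.
have [x xP] := sublevel_nested (co a) tP.
by exists x, t.
Qed.
End Attain.

(** * Gordan's alternative and the saddle point *)

Section FiniteBounds.
Variables (F : realFieldType) (J : eqType).
Implicit Types (r : seq J) (f : J -> F).

Lemma strict_sup_seq r f b : (forall i, i \in r -> f i < b) ->
  exists2 s, s < b & forall i, i \in r -> f i < s.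
Proof.
elim: r => [|j r IH] fb; first by exists (b - 1); rewrite ?ltrBlDr ?ltrDl.
have [|s sb sP] := IH; first by move=> i ir; apply: fb; rewrite inE ir orbT.
have fj := fb j (mem_head _ _).
have [fs|sf] := ltrP (f j) s.
  by exists s => // i; rewrite inE => /predU1P[->//|/sP].
exists ((f j + b) / 2) => [|i]; first lra.
rewrite inE => /predU1P[->|/sP]; first lra.
by lra.
Qed.

Lemma upper_bound_seq r f : exists b, forall i, i \in r -> f i < b.
Proof.
elim: r => [|j r [b bP]]; first by exists 0.
exists (Num.max b (f j + 1)) => i; rewrite inE lt_max.
by move=> /predU1P[->|/bP->//]; rewrite ltrDl ltr01 orbT.
Qed.

Lemma small_enough_seq r (P : J -> F -> Prop) :
  (forall i, exists2 d, 0 < d & forall e, 0 < e -> e <= d -> P i e) ->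
  exists2 e, 0 < e & forall i, i \in r -> P i e.
Proof.
move=> h; suff [d d0 dP] : exists2 d, 0 < d & forall e, 0 < e -> e <= d ->
    forall i, i \in r -> P i e by exists d => //; apply: dP.
elim: r => [|j r [d d0 dP]]; first by exists 1.
have [d' d'0 d'P] := h j; exists (Num.min d d'); first by rewrite lt_min d0.
move=> e e0; rewrite le_min => /andP[ed ed'] i; rewrite inE => /predU1P[->|].
  exact: d'P.
exact: dP.
Qed.
End FiniteBounds.

Definition rdot (F : nzRingType) m (u v : 'rV[F]_m) : F := (u *m v^T) 0 0.

Section Gordan.
Variables (F : realFieldType) (J : eqType) (m : nat).
Implicit Types (r : seq J) (g : J -> 'rV[F]_m).

Lemma rdotDl (u u' v : 'rV[F]_m) : rdot (u + u') v = rdot u v + rdot u' v.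
Proof. by rewrite /rdot mulmxDl mxE. Qed.
Lemma rdotZl k (u v : 'rV[F]_m) : rdot (k *: u) v = k * rdot u v.
Proof. by rewrite /rdot -scalemxAl mxE. Qed.
Lemma rdotDr (u v v' : 'rV[F]_m) : rdot u (v + v') = rdot u v + rdot u v'.
Proof. by rewrite /rdot linearD mulmxDr mxE. Qed.
Lemma rdotZr k (u v : 'rV[F]_m) : rdot u (k *: v) = k * rdot u v.
Proof. by rewrite /rdot linearZ -scalemxAr mxE. Qed.
Lemma rdot_gt0 (u : 'rV[F]_m) : u != 0 -> 0 < rdot u u.
Proof.
move=> u0; rewrite /rdot mxE lt_neqAle; apply/andP; split; last first.
  by apply: sumr_ge0 => j _; rewrite mxE -expr2 sqr_ge0.
apply: contraNneq u0 => /esym/eqP; rewrite psumr_eq0 => [/allP h|j _]; last first.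
  by rewrite mxE -expr2 sqr_ge0.
apply/eqP/rowP => j; have := h j (mem_index_enum _); rewrite !mxE /= mulf_eq0 orbb.
by move/eqP.
Qed.

(* The vectors rdot g0 d *: g i - rdot (g i) d *: g0 are orthogonal to d; a direction e good for
   them becomes good for g0 and the g i after adding a multiple of d. *)
Lemma gordan_step r (g : J -> 'rV[F]_m) (g0 d e : 'rV[F]_m) (j : J) : j \in r ->
  (forall i, i \in r -> rdot (g i) d < 0) -> 0 <= rdot g0 d ->
  (forall i, i \in r -> rdot (rdot g0 d *: g i - rdot (g i) d *: g0) e < 0) ->
  exists d', rdot g0 d' < 0 /\ forall i, i \in r -> rdot (g i) d' < 0.
Proof.
move=> jr dP c0 eP.
have {}eP i : i \in r -> rdot g0 d * rdot (g i) e < rdot (g i) d * rdot g0 e.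
  by move/eP; rewrite rdotDl -scaleNr !rdotZl mulNr subr_lt0.
(* The direction sought is [e + s *: d]. The vectors [g i] bound [s] from below and [g0] bounds it
   from above, the latter only when [rdot g0 d] is nonzero; [eP] says that these bounds are
   compatible. *)
suff [s s0 sP] : exists2 s, rdot g0 e + s * rdot g0 d < 0 &
    forall i, i \in r -> rdot (g i) e / - rdot (g i) d < s.
  exists (e + s *: d); rewrite rdotDr rdotZr; split=> // i ir.
  rewrite rdotDr rdotZr; have := sP i ir; have := dP i ir.
  by move=> di; rewrite ltr_pdivrMr ?oppr_gt0 // mulrN -subr_lt0 opprK.
have [c00|c0'] := eqVneq (rdot g0 d) 0.
  have [s sP] := upper_bound_seq r (fun i => rdot (g i) e / - rdot (g i) d).
  exists s => //; rewrite c00 mulr0 addr0.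
  by have := eP j jr; rewrite c00 mul0r nmulr_rgt0 // dP.
have {c0 c0'} c0 : 0 < rdot g0 d by rewrite lt_neqAle eq_sym c0'.
have [i ir|s sb sP] := @strict_sup_seq _ _ r (fun i => rdot (g i) e / - rdot (g i) d)
  (- rdot g0 e / rdot g0 d).
  rewrite ltr_pdivrMr ?oppr_gt0 ?dP // mulrAC ltr_pdivlMr //.
  by rewrite mulrNN mulrC [X in _ < X]mulrC eP.
by exists s => //; move: sb; rewrite ltr_pdivlMr // -subr_lt0 opprK addrC.
Qed.

(** Induction on the list. If a direction [d] good for the tail fails on the head [g j], the tail is
    replaced by combinations with [g j] orthogonal to [d], and the induction hypothesis is applied
    again: a direction is corrected by [gordan_step], multipliers are translated back. *)
Lemma gordan r g : uniq r ->
  (exists d, forall i, i \in r -> rdot (g i) d < 0) \/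
  exists w : J -> F, [/\ forall i, i \in r -> 0 <= w i, 0 < \sum_(i <- r) w i &
    \sum_(i <- r) w i *: g i = 0].
Proof.
elim: r g => [|j r IH] g /=; first by left; exists 0.
case/andP=> jr ur.
pose upd (w : J -> F) k i := if i == j then k else w i.
have updj w k : upd w k j = k by rewrite /upd eqxx.
have updr w k i : i \in r -> upd w k i = w i.
  by rewrite /upd; case: eqP => // -> ; rewrite (negPf jr).
have sum_upd (V : lmodType F) w k (h : J -> V) :
    \sum_(i <- j :: r) upd w k i *: h i = k *: h j + \sum_(i <- r) w i *: h i.
  by rewrite big_cons updj; congr (_ + _); apply: eq_big_seq => i /updr->.
have sum_upd1 w k : \sum_(i <- j :: r) upd w k i = k + \sum_(i <- r) w i.
  by rewrite big_cons updj; congr (_ + _); apply: eq_big_seq => i /updr->.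
have [[d dP]|[w [w0 wp wg]]] := IH g ur; last first.
  right; exists (upd w 0); split; rewrite ?sum_upd1 ?sum_upd ?add0r ?scale0r ?add0r //.
  by move=> i; rewrite inE => /predU1P[->|ir]; rewrite ?updj ?updr ?w0.
have [gd|gd] := ltrP (rdot (g j) d) 0.
  by left; exists d => i; rewrite inE => /predU1P[->|/dP].
have [gj0|gj0] := eqVneq (g j) 0.
  right; exists (upd (fun=> 0) 1); split.
  - by move=> i; rewrite inE => /predU1P[->|ir]; rewrite ?updj ?updr ?ler01.
  - by rewrite sum_upd1 big1 // addr0.
  by rewrite sum_upd gj0 scaler0 add0r big1 // => i _; rewrite scale0r.
case: r IH jr ur upd updj updr sum_upd sum_upd1 dP => [|j' r'].
  move=> *; left; exists (- g j) => i; rewrite mem_seq1 => /eqP->.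
  by rewrite -scaleN1r rdotZr mulN1r oppr_lt0 rdot_gt0.
set r := j' :: r' => IH jr ur upd updj updr sum_upd sum_upd1 dP.
have [[e eP]|[w [w0 wp wg]]] :=
  IH (fun i => rdot (g j) d *: g i - rdot (g i) d *: g j) ur.
  have [d' [d'j d'r]] := gordan_step (mem_head j' r') dP gd eP.
  by left; exists d' => i; rewrite inE => /predU1P[->|/d'r].
(* These are the coefficients of the [g i] and of [g j] after expanding the vanishing combination of
   the modified vectors. *)
right; exists (upd (fun i => w i * rdot (g j) d) (- \sum_(i <- r) w i * rdot (g i) d)).
split.
- move=> i; rewrite inE => /predU1P[->|ir]; rewrite ?updj ?updr ?mulr_ge0 ?w0 //.
  rewrite oppr_ge0 big_seq; apply: sumr_le0 => k kr.
  by rewrite mulr_ge0_le0 ?w0 // ltW // dP.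
(* As [rdot (g j) d] may be 0, positivity of the total comes from the weight on [j], to which a
   positive [w k] contributes strictly. *)
- have [k kr wk] : exists2 k, k \in r & 0 < w k.
    apply: NNPP => h; move: wp; rewrite ltNge big_seq sumr_le0 // => k kr.
    by rewrite leNgt; apply/negP => wk; apply: h; exists k.
  rewrite sum_upd1 -mulr_suml ltr_pwDl //; last by rewrite mulr_ge0 // ltW.
  rewrite oppr_gt0 (big_rem k) // big_seq_cond; apply: ltr_nwDl.
    by rewrite pmulr_rlt0 // dP.
  by apply: sumr_le0 => l /andP[/mem_rem lr _]; rewrite mulr_ge0_le0 ?w0 // ltW // dP.
rewrite sum_upd scaleNr scaler_suml addrC -sumrB -[RHS]wg; apply: eq_bigr => i _.
by rewrite scalerBr !scalerA.
Qed.
End Gordan.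

(** The two cases are those of an inactive constraint, which has slack, and of an active one, which
    decreases to first order. *)
Lemma quadratic_neg_near0 (F : realFieldType) (a0 a1 a2 : F) :
  0 <= a2 -> a0 < 0 \/ a0 = 0 /\ a1 < 0 ->
  exists2 d, 0 < d & forall e, 0 < e -> e <= d -> a0 + e * a1 + e ^+ 2 * a2 < 0.
Proof.
move=> a20 [a00|[-> a10]].
  have q0 : 0 < `|a1| + a2 + 1 by rewrite ltr_wpDl // addr_ge0.
  exists (Num.min 1 (- a0 / (`|a1| + a2 + 1))).
    by rewrite lt_min ltr01 divr_gt0 ?oppr_gt0.
  move=> e e0; rewrite le_min ler_pdivlMr // => /andP[e1 ea].
  have h1 : e * a1 <= e * `|a1| by rewrite ler_wpM2l ?ler_norm // ltW.
  have h2 : e ^+ 2 * a2 <= e * a2.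
    by rewrite ler_wpM2r // expr2 ger_pMr.
  by move: ea; rewrite !mulrDr mulr1 => ea; lra.
exists (- a1 / (a2 + 1)); first by rewrite divr_gt0 ?oppr_gt0 // ltr_wpDl.
move=> e e0; rewrite ler_pdivlMr ?ltr_wpDl // => ea.
by rewrite add0r expr2 -mulrA -mulrDr pmulr_rlt0 //; move: ea; rewrite mulrDr mulr1 => ea; lra.
Qed.

Section Saddle.
Variables (R : rcfType) (N : nat) (I : finType) (kap : 'I_N -> I).

Definition class_part (u : 'rV[R]_N) (i : I) : 'rV[R]_N :=
  \row_l (if kap l == i then u 0 l else 0).

(** The exact Taylor expansion at [u], with [class_part u i] as half gradient. *)
Lemma ssq_add (u w : 'rV[R]_N) i :
  ssq kap (u + w) i = ssq kap u i + rdot (class_part u i) w *+ 2 + ssq kap w i.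
Proof.
have -> : rdot (class_part u i) w = \sum_(l | kap l == i) u 0 l * w 0 l.
  rewrite /rdot mxE [RHS]big_mkcond; apply: eq_bigr => l _; rewrite !mxE.
  by case: ifP; rewrite ?mul0r.
rewrite -sumrMnl -!big_split /=; apply: eq_bigr => l _.
by rewrite mxE sqrrD.
Qed.

Lemma rdot_class_mul m (B : 'M[R]_(m, N)) u i x :
  rdot (class_part u i) (x *m B) = rdot (class_part u i *m B^T) x.
Proof. by rewrite /rdot trmx_mul mulmxA. Qed.

(* w consists of Gordan multipliers for the half gradients g i of the active constraints at the
   minimiser x. *)
Lemma saddle (i0 : I) m (a : 'rV[R]_N) (B : 'M[R]_(m, N)) :
  exists x t (w : I -> R), [/\ sublevel kap a B t x, forall i, 0 <= w i,
    \sum_i w i = 1 & forall x', t <= \sum_i w i * ssq kap (a + x' *m B) i].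
Proof.
have [x [t [xt tmin]]] := sublevel_min kap i0 a B.
pose u := a + x *m B; pose act := [seq i <- enum I | ssq kap u i == t].
pose g i := class_part u i *m B^T.
have [[d dP]|[w [w0 wp wg]]] := gordan g (filter_uniq (fun i => ssq kap u i == t) (enum_uniq I)).
  (* A common descent direction for the active constraints would, after a short step, lower every
     constraint below [t], against minimality. *)
  have [i|e e0 eP] := @small_enough_seq R I (enum I)
    (fun i e => (ssq kap u i - t) + e * (rdot (g i) d *+ 2) + e ^+ 2 * ssq kap (d *m B) i < 0).
    apply: quadratic_neg_near0; first exact: ssq_ge0.
    have [it|it] := eqVneq (ssq kap u i) t.
      right; rewrite it subrr; split=> //; rewrite pmulrn_llt0 //; apply: dP.
      by rewrite mem_filter mem_enum it eqxx.
    by left; rewrite subr_lt0 lt_neqAle it xt.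
  have [i _|t' t't t'P] := @strict_sup_seq R I (enum I)
    (fun i => ssq kap (a + (x + e *: d) *m B) i) t.
    have := eP i (mem_enum _ _).
    rewrite /= mulmxDl addrA -/u -scalemxAl (ssq_add u (e *: _)).
    rewrite -subr_lt0 rdotZr rdot_class_mul -/(g i) => h.
    have -> : ssq kap (e *: (d *m B)) i = e ^+ 2 * ssq kap (d *m B) i.
      by rewrite mulr_sumr; apply: eq_bigr => l _; rewrite !mxE exprMn.
    by move: h; rewrite mulrnAr; lra.
  suff : t <= t' by rewrite leNgt t't.
  by apply: (tmin t' (x + e *: d)) => i; rewrite ltW // t'P // mem_enum.
pose s := \sum_(i <- act) w i.
pose w' i := if ssq kap u i == t then w i / s else 0.
have w'E (V : lmodType R) (h : I -> V) :
    \sum_i w' i *: h i = s^-1 *: \sum_(i <- act) w i *: h i.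
  rewrite /act big_filter big_enum_cond /= scaler_sumr [RHS]big_mkcond /=.
  apply: eq_bigr => i _; rewrite /w'; case: ifP => _; rewrite ?scale0r //.
  by rewrite scalerA mulrC.
have w'0 i : 0 <= w' i.
  rewrite /w'; case: ifP => // it; rewrite divr_ge0 ?(ltW wp) ?w0 //.
  by rewrite mem_filter it mem_enum.
have w'1 : \sum_i w' i = 1.
  rewrite (eq_bigr (fun i => w' i *: (1 : R^o))) => [|i _]; last by rewrite /GRing.scale /= mulr1.
  rewrite (w'E R^o (fun=> 1)) -scaler_suml /GRing.scale /= mulr1.
  by rewrite mulVf // gt_eqF.
exists x, t, w'; split=> // x'; pose z := x' - x.
have -> : a + x' *m B = u + z *m B.
  by rewrite mulmxBl /u -addrA; congr (_ + _); rewrite addrC subrK.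
have termE i : w' i * ssq kap (u + z *m B) i =
    w' i * t + rdot (w' i *: g i) z *+ 2 + w' i * ssq kap (z *m B) i.
  rewrite ssq_add rdot_class_mul -/(g i) rdotZl 2!mulrDr mulrnAr; congr (_ + _ + _).
  by rewrite /w'; case: eqP => [->|]; rewrite ?mul0r.
(* The linear terms cancel in the weighted sum, and the quadratic remainders are nonnegative. *)
have dot0 : \sum_i rdot (w' i *: g i) z = 0.
  transitivity (rdot (\sum_i w' i *: g i) z).
    by rewrite /rdot mulmx_suml summxE.
  by rewrite w'E wg scaler0 /rdot mul0mx mxE.
rewrite (eq_bigr _ (fun i _ => termE i)) !big_split /= -mulr_suml w'1 mul1r.
rewrite dot0 !addr0 lerDl; apply: sumr_ge0 => i _.
by rewrite mulr_ge0 // ssq_ge0.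
Qed.
End Saddle.

(** * The saddle point for complex residuals *)

Section ComplexSaddle.
Variables (C : numClosedFieldType) (I : finType) (i0 : I).

Definition cre (z : C) : creal C := CReal (Creal_Re z).
Definition cim (z : C) : creal C := CReal (Creal_Im z).

(** With real parameters, the real and imaginary parts of each residual are real affine functions;
    [kap] groups the two parts into one block. *)
Lemma real_param_saddle m (c : I -> C) (b : I -> 'I_m -> C) :
  exists (x : 'I_m -> C) (t : C) (w : I -> C),
  [/\ forall j, x j \is Num.real,
      forall i, `|c i + \sum_j x j * b i j| ^+ 2 <= t, forall i, 0 <= w i,
      \sum_i w i = 1 &
      forall x' : 'I_m -> C, (forall j, x' j \is Num.real) ->
        t <= \sum_i w i * `|c i + \sum_j x' j * b i j| ^+ 2].
Proof.
pose n := #|I|.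
pose kap (l : 'I_(n + n)) : I :=
  match split l with inl j => enum_val j | inr j => enum_val j end.
pose a : 'rV[creal C]_(n + n) :=
  row_mx (\row_j cre (c (enum_val j))) (\row_j cim (c (enum_val j))).
pose B : 'M[creal C]_(m, n + n) :=
  row_mx (\matrix_(j, l) cre (b (enum_val l) j)) (\matrix_(j, l) cim (b (enum_val l) j)).
have ssqE (x : 'rV[creal C]_m) i :
    creal_val (ssq kap (a + x *m B) i) = `|c i + \sum_j creal_val (x 0 j) * b i j| ^+ 2.
  have kl j : (kap (lshift n j) == i) = (enum_val j == i) by rewrite /kap (unsplitK (inl j)).
  have kr j : (kap (rshift n j) == i) = (enum_val j == i) by rewrite /kap (unsplitK (inr j)).
  have pick_i (F : 'I_n -> creal C) : \sum_(j | enum_val j == i) F j = F (enum_rank i).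
    by apply: big_pred1 => j; rewrite /= -[RHS](inj_eq enum_val_inj) enum_rankK.
  rewrite /ssq big_split_ord /=.
  rewrite (eq_bigl _ _ kl) (eq_bigl _ _ kr) !pick_i mul_mx_row add_row_mx row_mxEl row_mxEr !mxE !enum_rankK.
  rewrite !rmorphXn !rmorphD !rmorph_sum /= normC2_Re_Im !raddfD !raddf_sum /=.
  congr ((_ + _) ^+ 2 + (_ + _) ^+ 2); apply: eq_bigr => j _; rewrite !mxE /= enum_rankK.
    by rewrite ReMl ?creal_valP.
  by rewrite ImMl ?creal_valP.
have [x [t [w [xt w0 w1 tmin]]]] := saddle kap i0 a B.
exists (fun j => creal_val (x 0 j)), (creal_val t), (fun i => creal_val (w i)); split.
- by move=> j; apply: creal_valP.
- by move=> i; rewrite -ssqE; apply: xt.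
- by move=> i; apply: w0.
- by rewrite -rmorph_sum w1.
move=> x' x'r.
have : creal_val t <= creal_val (\sum_i w i *
    ssq kap (a + (\row_j CReal (x'r j)) *m B) i) by apply: tmin.
rewrite rmorph_sum /=.
under eq_bigr do rewrite ssqE.
congr (_ <= _); apply: eq_bigr => i _; congr (_ * `|_ + _| ^+ 2).
by apply: eq_bigr => j _; rewrite mxE.
Qed.

Lemma complex_saddle realF k (c : I -> C) (p : I -> 'I_k -> C) :
  exists (al : 'I_k -> C) (t : C) (w : I -> C),
  [/\ inFcoef realF al,
      forall i, `|c i - \sum_j al j * p i j| ^+ 2 <= t, forall i, 0 <= w i,
      \sum_i w i = 1 &
      forall al' : 'I_k -> C, inFcoef realF al' ->
        t <= \sum_i w i * `|c i - \sum_j al' j * p i j| ^+ 2].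
Proof.
case: realF.
  have [x [t [w [xr xt w0 w1 tmin]]]] := real_param_saddle c (fun i j => - p i j).
  have E (y : 'I_k -> C) i : c i - \sum_j y j * p i j = c i + \sum_j y j * - p i j.
    by rewrite -sumrN; congr (_ + _); apply: eq_bigr => j _; rewrite mulrN.
  exists x, t, w; split=> // [i|al' /(_ isT) al'r]; first by rewrite E.
  by under eq_bigr do rewrite E; apply: tmin.
(* Each complex coefficient becomes two real ones, for [p i l] and for ['i * p i l]. *)
pose b i (j : 'I_(k + k)) := match split j with inl l => - p i l | inr l => - ('i * p i l) end.
have [x [t [w [xr xt w0 w1 tmin]]]] := real_param_saddle c b.
have E (y : 'I_(k + k) -> C) i : c i + \sum_j y j * b i j =
    c i - \sum_j (y (lshift k j) + 'i * y (rshift k j)) * p i j.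
  rewrite big_split_ord /= -sumrN; congr (_ + _); rewrite -big_split /=.
  apply: eq_bigr => j _.
  rewrite /b (unsplitK (inl j)) (unsplitK (inr j)) !mulrN -opprD mulrDl.
  by rewrite [_ * ('i * _)]mulrCA mulrA.
exists (fun j => x (lshift k j) + 'i * x (rshift k j)), t, w; split=> // [i|al' _].
  by rewrite -E.
pose y (j : 'I_(k + k)) := match split j with inl l => 'Re (al' l) | inr l => 'Im (al' l) end.
have := tmin y; under eq_bigr do rewrite E.
have -> : \sum_i w i * `|c i - \sum_j (y (lshift k j) + 'i * y (rshift k j)) * p i j| ^+ 2 =
    \sum_i w i * `|c i - \sum_j al' j * p i j| ^+ 2.
  apply: eq_bigr => i _; congr (_ * `|_ - _| ^+ 2); apply: eq_bigr => j _.
  by rewrite /y (unsplitK (inl j)) (unsplitK (inr j)) -Crect.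
by apply=> j; rewrite /y; case: split => l; [apply: Creal_Re|apply: Creal_Im].
Qed.
End ComplexSaddle.

(** * Spectral weights *)

Lemma mulmx_col (R : pzSemiRingType) m n p (A : 'M[R]_(m, n)) (B : 'M[R]_(n, p)) j :
  A *m col j B = col j (A *m B).
Proof. by apply/matrixP => i l; rewrite !mxE; apply: eq_bigr => k _; rewrite mxE. Qed.

Section SpectralWeights.
Variables (C : numClosedFieldType) (n : nat) (Q : 'M[C]_n) (lam : 'I_n -> C).
Hypothesis Qunitary : Q \is unitarymx.
Implicit Types (x v : 'cV[C]_n).

Definition sqn m (x : 'cV[C]_m) : C := \sum_i `|x i 0| ^+ 2.
(** For unitary [Q], the coordinates of [x] in the orthonormal eigenbasis formed by its columns. *)
Definition qhat x : 'cV[C]_n := Q ^t* *m x.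

Lemma sqn_ge0 m (x : 'cV[C]_m) : 0 <= sqn x.
Proof. by apply: sumr_ge0 => i _; rewrite exprn_ge0. Qed.

Lemma sqnE m (x : 'cV[C]_m) : sqn x = (x ^t* *m x) 0 0.
Proof. by rewrite mxE; apply: eq_bigr => i _; rewrite !mxE mulrC -normCK. Qed.

Lemma mulQtQ : Q ^t* *m Q = 1%:M.
Proof. by apply: mulmx1C; apply/unitarymxP. Qed.

Lemma mulQQt : Q *m Q ^t* = 1%:M.
Proof. exact/unitarymxP. Qed.

Lemma sqn_mulQ x : sqn (Q *m x) = sqn x.
Proof.
by rewrite !sqnE trmx_mul map_mxM -mulmxA [_ *m (Q *m x)]mulmxA mulQtQ mul1mx.
Qed.

Lemma sqn_qhat x : sqn (qhat x) = sqn x.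
Proof. by rewrite -sqn_mulQ mulmxA mulQQt mul1mx. Qed.

Lemma sqn_mxfun g x :
  sqn (mxfun Q lam g *m x) = \sum_l `|g (lam l)| ^+ 2 * `|qhat x l 0| ^+ 2.
Proof.
rewrite /mxfun -!mulmxA sqn_mulQ; apply: eq_bigr => l _.
by rewrite mul_diag_mx mxE mxE normrM exprMn.
Qed.

Lemma mxfun_residual k f (phi : 'I_k -> C -> C) al :
  mxfun Q lam f - mxcomb Q lam phi al =
  mxfun Q lam (fun z => f z - \sum_i al i * phi i z).
Proof.
rewrite /mxcomb /mxfun.
under eq_bigr do rewrite -!mulmxA scalemxAr scalemxAl.
rewrite -mulmx_sumr -mulmx_suml -[in X in X - _]mulmxA -mulmxBr -mulmxBl mulmxA.
congr (_ *m _ *m _); apply/matrixP => i j; rewrite !mxE summxE.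
have [->|ij] := eqVneq i j; last first.
  by rewrite mulr0n big1 ?subr0 // => l _; rewrite !mxE (negPf ij) mulr0.
by rewrite mulr1n; congr (_ - _); apply: eq_bigr => l _; rewrite !mxE eqxx.
Qed.

(* rep selects a representative in each class of indices; v puts the total weight of a class on
   the vector u of its representative. *)
Lemma realize_weights realF (rep : 'I_n -> 'I_n) (u : 'I_n -> 'cV[C]_n) (w : 'I_n -> C) :
  (forall i, rep (rep i) = rep i) -> (forall i, inFvec realF (u i)) ->
  (forall i, sqn (u i) = 1) ->
  (forall i l, qhat (u i) l 0 != 0 -> rep l = rep i) ->
  (forall i, 0 <= w i) ->
  exists2 v, inFvec realF v & forall h : 'I_n -> C, (forall l, h (rep l) = h l) ->
    \sum_l h l * `|qhat v l 0| ^+ 2 = \sum_i w i * h i.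
Proof.
move=> repK uF u1 urep w0; pose W i := \sum_(j | rep j == i) w j.
have W0 i : 0 <= W i by apply: sumr_ge0.
have Wrep i : rep i != i -> W i = 0.
  by move=> ri; rewrite /W big1 // => j /eqP rj; rewrite -rj repK eqxx in ri.
exists (\sum_i sqrtC (W i) *: u i) => [rF i|h hrep].
  rewrite summxE rpred_sum // => j _; rewrite mxE rpredM ?uF //.
  by rewrite ger0_real // sqrtC_ge0.
(* Only the representative of the class of [l] contributes: other indices either carry weight 0 or
   have a vector without component at [l]. *)
have vhat l : qhat (\sum_i sqrtC (W i) *: u i) l 0 =
    sqrtC (W (rep l)) * qhat (u (rep l)) l 0.
  rewrite /qhat mulmx_sumr summxE (bigD1 (rep l)) //= big1 ?addr0 => [|i il].
    by rewrite -scalemxAr mxE.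
  rewrite -scalemxAr mxE -/(qhat (u i)).
  have [ri|/Wrep->] := eqVneq (rep i) i; last by rewrite sqrtC0 mul0r.
  have [->|/urep] := eqVneq (qhat (u i) l 0) 0; first by rewrite mulr0.
  by rewrite ri => li; rewrite li eqxx in il.
under eq_bigr => l _ do rewrite vhat normrM exprMn -normrX sqrtCK (ger0_norm (W0 _)) -hrep.
have -> : \sum_i w i * h i = \sum_i W i * h i.
  rewrite (partition_big rep xpredT) //=; apply: eq_bigr => i _.
  by rewrite mulr_suml; apply: eq_bigr => j /eqP <-; rewrite hrep.
rewrite (partition_big rep xpredT) //=; apply: eq_bigr => i _.
have [ri|/Wrep Wi] := eqVneq (rep i) i; last first.
  by rewrite Wi mul0r big1 // => j /eqP ->; rewrite Wi mul0r mulr0.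
transitivity (\sum_(l | rep l == i) W i * h i * `|qhat (u i) l 0| ^+ 2).
  by apply: eq_bigr => l /eqP ->; rewrite mulrA [h i * _]mulrC.
rewrite -mulr_sumr -[RHS]mulr1 -(u1 i) -sqn_qhat; congr (_ * _).
rewrite /sqn [RHS](bigID (fun l => rep l == i)) /= [X in _ + X]big1 ?addr0 // => l li.
have [->|/urep] := eqVneq (qhat (u i) l 0) 0; first by rewrite normr0 expr0n.
by rewrite ri => /eqP; rewrite (negPf li).
Qed.

End SpectralWeights.

(** * Conjugate eigenvalues of a real matrix *)

Section Conjugation.
Variables (C : numClosedFieldType) (n : nat) (Q : 'M[C]_n) (lam : 'I_n -> C).
Hypothesis Qunitary : Q \is unitarymx.
Hypothesis Areal : Q *m diag_mx (\row_j lam j) *m Q ^t* \is a realmx.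

(* As A is real, the conjugate of column i of Q is an eigenvector for the conjugate of lam i. *)
Lemma conj_overlap i l : (Q ^t* *m map_mx Num.conj Q) l i != 0 -> lam l = (lam i)^*.
Proof.
set G := _ *m map_mx _ _ => Gli.
(* [G] intertwines the diagonal matrices of the eigenvalues and of their conjugates; comparing the
   entries at [(l, i)] concludes. *)
have : diag_mx (\row_j lam j) *m G = G *m diag_mx (\row_j (lam j)^*).
  transitivity (Q ^t* *m (Q *m diag_mx (\row_j lam j) *m Q ^t*) *m map_mx Num.conj Q).
    by rewrite !mulmxA mulQtQ // mul1mx.
  rewrite -(realmxC Areal) !map_mxM map_diag_mx -!mulmxA; congr (_ *m (_ *m _)).
  have -> : map_mx Num.conj (Q ^t*) *m map_mx Num.conj Q = 1%:M.
    by rewrite -map_mxM mulQtQ // map_mx1.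
  by rewrite mulmx1; congr diag_mx; apply/rowP => j; rewrite !mxE.
move: Gli; move: (G) => H Hli /matrixP/(_ l i).
by rewrite mul_diag_mx mul_mx_diag !mxE mulrC => /(mulfI Hli).
Qed.

(** Normalise twice the real part of a multiple of column [i] of [Q]. It is a combination of this
    column and its conjugate, and [conj_overlap] locates the components of the latter. *)
Lemma real_vector_near_eigenvector i : exists u : 'cV[C]_n,
  [/\ forall k, u k 0 \is Num.real, sqn u = 1 &
    forall l, qhat Q u l 0 != 0 -> l = i \/ lam l = (lam i)^*].
Proof.
pose U a : 'cV[C]_n := a *: col i Q + a^* *: col i (map_mx Num.conj Q).
have UE a k : U a k 0 = a * Q k i + (a * Q k i)^* by rewrite !mxE rmorphM.
(* If both [U 1] and [U 'i] vanished, so would the real and imaginary parts of a column of a unitary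
   matrix. *)
have [a Ua] : exists a, U a != 0.
  have [U1|] := eqVneq (U 1) 0; last by exists 1.
  exists 'i; apply/eqP => Ui.
  have Q0 k : Q k i = 0.
    have E1 : Q k i + (Q k i)^* = 0.
      by have := congr1 (fun M : 'cV[C]_n => M k 0) U1; rewrite /= UE !mul1r mxE.
    have : 'i * (Q k i - (Q k i)^*) = 0.
      have := congr1 (fun M : 'cV[C]_n => M k 0) Ui.
      by rewrite /= UE rmorphM /= conjCi mulNr -mulrBr mxE.
    move/eqP; rewrite mulf_eq0 (negPf (neq0Ci C)) subr_eq0 => /eqP E2.
    by move/eqP: E1; rewrite -E2 -mulr2n mulrn_eq0 => /eqP.
  have : (Q ^t* *m Q) i i = 1 by rewrite mulQtQ // mxE eqxx.
  rewrite mxE big1 => [/eqP|k _]; last by rewrite Q0 mulr0.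
  by rewrite eq_sym oner_eq0.
have s0 : 0 < sqn (U a).
  rewrite lt_neqAle sqn_ge0 andbT eq_sym; apply: contraNneq Ua.
  move=> /eqP; rewrite psumr_eq0 => [/allP h|k _]; last by rewrite exprn_ge0.
  apply/eqP/matrixP => k j; rewrite ord1 [RHS]mxE; apply/eqP.
  by have := h k (mem_index_enum _); rewrite expf_eq0 normr_eq0.
pose c := (sqrtC (sqn (U a)))^-1.
have cr : c \is Num.real by rewrite realV ger0_real // sqrtC_ge0 ltW.
exists (c *: U a); split=> [k||l ul].
- by rewrite mxE rpredM // UE; apply/CrealP; rewrite rmorphD /= conjCK addrC.
- rewrite /sqn; under eq_bigr do rewrite mxE normrM exprMn.
  rewrite -mulr_sumr -/(sqn _) /c normfV exprVn -normrX sqrtCK.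
  by rewrite (ger0_norm (ltW s0)) mulVf // gt_eqF.
have [->|li] := eqVneq l i; [by left | right].
apply: conj_overlap; move: ul; apply: contraNneq => G0.
rewrite /qhat -scalemxAr mulmxDr -!scalemxAr !mulmx_col mulQtQ //.
rewrite !mxE (negPf li) mulr0 add0r.
by move: G0; rewrite mxE => ->; rewrite !mulr0.
Qed.
End Conjugation.

Section Choose.
Variables (C : numClosedFieldType) (n : nat) (lam : 'I_n -> C).

Definition conj_related (i l : 'I_n) := (lam l == lam i) || (lam l == (lam i)^*).
Definition conj_rep (i : 'I_n) : 'I_n := odflt i [pick l | conj_related i l].

Lemma conj_rep_related i : conj_related i (conj_rep i).
Proof.
rewrite /conj_rep; case: pickP => //= /(_ i).
by rewrite /conj_related eqxx.
Qed.

Lemma conj_rep_eq i l : conj_related i l -> conj_rep l = conj_rep i.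
Proof.
move=> il; have E : conj_related l =1 conj_related i.
  move=> j; move: il; rewrite /conj_related => /orP[]/eqP-> //.
  by rewrite conjCK orbC.
rewrite /conj_rep (eq_pick E); case: pickP => //= /(_ l).
by rewrite il.
Qed.
End Choose.

(** In the real case the classes join equal or conjugate eigenvalues and the vectors are the real
    ones built above; in the complex case each index is its own class, with the columns of [Q] as
    vectors. *)
Lemma adapted_vectors (C : numClosedFieldType) (realF : bool) n (Q : 'M[C]_n) (lam : 'I_n -> C) :
  Q \is unitarymx -> inFmx realF (Q *m diag_mx (\row_j lam j) *m Q ^t*) ->
  exists (rep : 'I_n -> 'I_n) (u : 'I_n -> 'cV[C]_n),
  [/\ forall i, rep (rep i) = rep i,
      forall i, if realF then conj_related lam i (rep i) else rep i == i,
      forall i, inFvec realF (u i), forall i, sqn (u i) = 1 &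
      forall i l, qhat Q (u i) l 0 != 0 -> rep l = rep i].
Proof.
move=> Qu; case: realF => AF.
  have [u uP] := fin_all_exists (real_vector_near_eigenvector Qu (AF isT)).
  exists (conj_rep lam), u; split=> [i|i|i _|i|i l].
  - exact/conj_rep_eq/conj_rep_related.
  - exact: conj_rep_related.
  - by have [] := uP i.
  - by have [] := uP i.
  have [_ _ h] := uP i; move=> /h[->//|li].
  by apply: conj_rep_eq; rewrite /conj_related li eqxx orbT.
have qcol i : qhat Q (col i Q) = col i 1%:M by rewrite /qhat mulmx_col mulQtQ.
exists id, (fun i => col i Q); split=> // [i|i l].
  rewrite -(sqn_qhat Qu) qcol /sqn (bigD1 i) //= big1 ?addr0 => [|l li].
    by rewrite !mxE eqxx normr1 expr1n.
  by rewrite !mxE (negPf li) normr0 expr0n.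
by rewrite qcol !mxE; have [->|li] := eqVneq l i; rewrite ?mulr0n ?eqxx.
Qed.

(** * From the saddle point to the minimax equality *)

Theorem theorem1 (C : numClosedFieldType) (realF : bool) (n k : nat)
  (hn : (0 < n)%N)
  (A : 'M[C]_n) (Q : 'M[C]_n) (lam : 'I_n -> C)
  (f : C -> C) (phi : 'I_k -> C -> C)
  (hAF : inFmx realF A)
  (hAnormal : A \is normalmx)
  (hQ : Q \is unitarymx)
  (hdiag : A = Q *m diag_mx (\row_j lam j) *m Q ^t*)
  (hreal : realF ->
     forall j : 'I_n, (f (lam j))^* = f ((lam j)^*) /\
                      forall i : 'I_k, (phi i (lam j))^* = phi i ((lam j)^*)) :
  exists r : C,
    is_max (fun s => exists v : 'cV[C]_n,
              [/\ inFvec realF v, vnorm v = 1 &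
                  is_min (fun t => exists alpha : 'I_k -> C,
                            inFcoef realF alpha /\
                            t = vnorm ((mxfun Q lam f - mxcomb Q lam phi alpha) *m v)) s]) r
    /\
    is_min (fun t => exists alpha : 'I_k -> C,
              inFcoef realF alpha /\
              is_specnorm realF (mxfun Q lam f - mxcomb Q lam phi alpha) t) r.
Proof.
have gE al : mxfun Q lam f - mxcomb Q lam phi al =
  mxfun Q lam (fun z => f z - \sum_i al i * phi i z) by apply: mxfun_residual.
pose q al l := `|f (lam l) - \sum_i al i * phi i (lam l)| ^+ 2.
have sqnM al x : sqn ((mxfun Q lam f - mxcomb Q lam phi al) *m x) =
  \sum_l q al l * `|qhat Q x l 0| ^+ 2 by rewrite gE sqn_mxfun.
rewrite hdiag in hAF.
have [rep [u [repK repR uF u1 urep]]] := adapted_vectors hQ hAF.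
(* Over the reals, [hreal] and real coefficients make the residuals at conjugate eigenvalues
   conjugate, so their moduli are constant on classes. *)
have qrep al l : inFcoef realF al -> q al (rep l) = q al l.
  move=> alF; have := repR l; rewrite /q.
  have [rF|_] := boolP realF; last by move/eqP->.
  case/orP => /eqP -> //; rewrite -[in RHS]norm_conjC rmorphB rmorph_sum /=.
  have [-> ph] := hreal rF l; congr (`|_ - _| ^+ 2); apply: eq_bigr => i _.
  by rewrite rmorphM /= ph (conj_Creal (alF rF i)).
have [al [t [w [alF alt w0 w1 tmin]]]] := complex_saddle (Ordinal hn) realF
  (fun l => f (lam l)) (fun l i => phi i (lam l)).
have [v vF vP] := realize_weights hQ repK uF u1 urep w0.
(* The constant function 1 in [vP] turns the total weight 1 into the squared norm of [v]. *)
have v1 : sqn v = 1.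
  have := vP (fun=> 1) (fun _ => erefl); rewrite -(sqn_qhat hQ) /sqn.
  by under eq_bigr do rewrite mul1r; under [RHS]eq_bigr do rewrite mulr1; rewrite w1 => ->.
have sqnv al' : inFcoef realF al' ->
    sqn ((mxfun Q lam f - mxcomb Q lam phi al') *m v) = \sum_i w i * q al' i.
  by move=> al'F; rewrite sqnM; apply: vP => l; apply: qrep.
(* The pair [al], [v] is a saddle point: [al] keeps the squared residual at most [t] on every unit
   vector, and [v] keeps it at least [t] for every admissible coefficient vector. *)
have upper x : sqn x = 1 -> sqn ((mxfun Q lam f - mxcomb Q lam phi al) *m x) <= t.
  move=> x1; rewrite sqnM -[t]mulr1 -x1 -(sqn_qhat hQ) mulr_sumr.
  by apply: ler_sum => l _; rewrite ler_wpM2r ?exprn_ge0 //; apply: alt.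
have lower al' : inFcoef realF al' ->
    t <= sqn ((mxfun Q lam f - mxcomb Q lam phi al') *m v).
  by move=> al'F; rewrite sqnv //; apply: tmin.
have tE : sqn ((mxfun Q lam f - mxcomb Q lam phi al) *m v) = t.
  by apply/le_anti/andP; split; [apply: upper|apply: lower].
have t0 : 0 <= t by rewrite -tE sqn_ge0.
have vnorm1 x : vnorm x = 1 -> sqn x = 1 by move/(congr1 (fun z => z ^+ 2)); rewrite sqrtCK expr1n.
have le_vnorm m (x : 'cV[C]_m) : t <= sqn x -> sqrtC t <= vnorm x.
  by move=> tx; rewrite /vnorm -/(sqn _) ler_sqrtC // nnegrE sqn_ge0.
have vnorm_le m (x : 'cV[C]_m) : sqn x <= t -> vnorm x <= sqrtC t.
  by move=> xt; rewrite /vnorm -/(sqn _) ler_sqrtC // nnegrE sqn_ge0.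
have vnormv : vnorm v = 1 by rewrite /vnorm -/(sqn v) v1 sqrtC1.
exists (sqrtC t); split; split.
- exists v; split=> //; split.
    by exists al; split=> //; rewrite /vnorm -/(sqn _) tE.
  by move=> s [al' [al'F ->]]; apply/le_vnorm/lower.
- move=> s [x [xF x1 [_ smin]]].
  apply: le_trans (smin _ (ex_intro _ al (conj alF erefl))) _.
  by apply/vnorm_le/upper/vnorm1.
- exists al; split=> //; split.
    by exists v; split=> //; rewrite /vnorm -/(sqn _) tE.
  move=> s [x [xF x1 ->]].
  by apply/vnorm_le/upper/vnorm1.
move=> s [al' [al'F [_ smax]]].
apply: le_trans (smax _ (ex_intro _ v (And3 vF vnormv erefl))).
by apply/le_vnorm/lower.
Qed.
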